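(* For a positive integer $n$, let $\mathcal{E}(n)$ be the set of integers $m$ with $\frac{n^2}{10}+\frac{n^2}{\log n}\le m\le \frac{n^2-n}{2}-\frac{n^2}{\log n}$ such that $\mathcal{R}(m)=0$, where $\mathcal{R}(m)$ is the number of integer quadruples $(x_1,x_2,x_3,x_4)$ with $1\le x_i\le \frac n5-\frac{n}{\log n}$ for $1\le i\le 4$ and $$x_1^2+x_2^2+x_3^2+x_4^2+(x_1+x_2+x_3+x_4-n)^2=2m+n.$$ Then $|\mathcal{E}(n)|=O\big(n^{2-\frac{1}{50}}\big)$ as $n\to\infty$.
   Context: $\log$ denotes the natural logarithm. *)

(* Defs.v *)
From mathcomp Require Import all_boot all_order all_algebra finmap.
From mathcomp Require Import all_classical all_reals all_analysis.
Set Implicit Arguments.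
Unset Strict Implicit.
Unset Printing Implicit Defensive.
Import Order.TTheory GRing.Theory Num.Theory.
Import numFieldNormedType.Exports.
Local Open Scope classical_set_scope.
Local Open Scope ring_scope.

(* As [ln 1 = 0] and [x / 0 = 0], the bounds involving [ln n] are meaningless
   for [n <= 1], which is harmless in a statement about [n] tending to
   infinity. *)

Definition representation (R : realType) (n : nat) (m : int) :
    set (int * int * int * int) :=
  [set x | let: (x1, x2, x3, x4) := x in
    (forall y, y \in [:: x1; x2; x3; x4] ->
       1 <= y /\ y%:~R <= n%:R / 5 - n%:R / ln n%:R :> R) /\
    x1 ^+ 2 + x2 ^+ 2 + x3 ^+ 2 + x4 ^+ 2 + (x1 + x2 + x3 + x4 - n%:Z) ^+ 2
      = 2 * m + n%:Z].

(* [fset_set] is empty on infinite sets; [representation_finite] and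
   [exceptional_finite] show that this case does not arise. *)
Definition nb_representations (R : realType) (n : nat) (m : int) : nat :=
  #|` fset_set (representation R n m)|.

Definition exceptional (R : realType) (n : nat) : set int :=
  [set m | n%:R ^+ 2 / 10 + n%:R ^+ 2 / ln n%:R <= m%:~R :> R /\
           m%:~R <= (n%:R ^+ 2 - n%:R) / 2 - n%:R ^+ 2 / ln n%:R :> R /\
           nb_representations R n m = 0%N].

Lemma finite_int_bounded (R : realType) (a b : R) :
  finite_set [set m : int | a <= m%:~R /\ m%:~R <= b].
Proof.
pose N := (Num.truncn `|a| + Num.truncn `|b|).+2.
apply: (@sub_finite_set _ _ ((fun k : nat => k%:Z - N%:Z) @` `I_(N.*2))).
  move=> m [am mb].
  have Na : `|a| < N%:R.
    apply: lt_le_trans (truncnS_gt _) _.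
    by rewrite ler_nat ltnS leqW ?leq_addr.
  have Nb : `|b| < N%:R.
    apply: lt_le_trans (truncnS_gt _) _.
    by rewrite ler_nat ltnS leqW ?leq_addl.
  have m1 : - N%:Z <= m.
    rewrite -(ler_int R) rmorphN/=; apply: le_trans am.
    by rewrite lerNl (le_trans _ (ltW Na))// -normrN ler_norm.
  have m2 : m < N%:Z.
    by rewrite -(ltr_int R) (le_lt_trans mb)// (le_lt_trans (ler_norm b)).
  have mN : 0 <= m + N%:Z by rewrite -lerBlDr sub0r.
  exists (absz (m + N%:Z)) => /=; last by rewrite gez0_abs// addrK.
  by rewrite -ltz_nat gez0_abs// -addnn PoszD ltrD2r.
exact/finite_image/finite_II.
Qed.

Lemma representation_finite (R : realType) (n : nat) (m : int) :
  finite_set (representation R n m).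
Proof.
pose A := [set y : int | 1 <= y%:~R :> R /\
  y%:~R <= n%:R / 5 - n%:R / ln n%:R :> R].
have fA : finite_set A by exact: finite_int_bounded.
apply: (@sub_finite_set _ _ (A `*` A `*` A `*` A)); last first.
  by do 3!apply: finite_setX => //.
move=> [[[x1 x2] x3] x4] [h _] /=.
have hA y : y \in [:: x1; x2; x3; x4] -> A y.
  by move=> /h[y1 yb]; split => //; rewrite -(ler_int R) in y1.
by split; [split; [split|]|]; apply: hA; rewrite !inE eqxx ?orbT.
Qed.

Lemma exceptional_finite (R : realType) (n : nat) :
  finite_set (exceptional R n).
Proof.
apply: sub_finite_set (@finite_int_bounded R
  (n%:R ^+ 2 / 10 + n%:R ^+ 2 / ln n%:R)
  ((n%:R ^+ 2 - n%:R) / 2 - n%:R ^+ 2 / ln n%:R)) => m [? []//].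
Qed.

(* Main.v *)
Require Import Defs.
From mathcomp Require Import all_boot all_order all_algebra finmap.
From mathcomp Require Import all_classical all_reals all_analysis.
From mathcomp Require Import zify ring lra.
Set Implicit Arguments.
Unset Strict Implicit.
Unset Printing Implicit Defensive.
Import Order.TTheory GRing.Theory Num.Theory.
Import numFieldNormedType.Exports.
Local Open Scope classical_set_scope.
Local Open Scope ring_scope.

(** The exceptional set is empty for large [n].  Put [N = 2m + n]; we look for
    [x5] and [x1, .., x4] with sum [n] and sum of squares [N].  Choose [x5] of
    the parity opposite to [n], just below the larger root of
    [x5^2 + (n - x5)^2 / 4 = N], and let [b = n - x5].  Then
    [D = 4 (N - x5^2) - b^2] is positive, [O(n)] and congruent to 3 mod 8, so
    that it is a sum [x^2 + y^2 + z^2] of three odd squares, and, as in Cauchy's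
    proof of the polygonal number theorem, the numbers [(b +- x +- y +- z) / 4]
    have sum [b] and sum of squares [N - x5^2].  They differ from [b / 4] by
    [O(sqrt n)] only, and the margins [n^2 / log n] and [n / log n] leave room
    for that.

    That every [D = 3 mod 8] is a sum of three odd squares is proved by
    comparing the number [r(D)] of such representations with the number [g(D)]
    of solutions of [AB + BC + CA = D] in positive odd integers, which is
    positive because of [A = B = 1].  For odd [n], both satisfy the recursion
    [\sum_(k odd) (k^2 - n) f(4n - k^2) = 0], which determines [f(4n - 1)] from
    earlier values up to a common factor.  For [r] this is the symmetry of
    [k^2 + x^2 + y^2 + z^2 = 4n].  For [g] it amounts to
    [\sum (A - k) (B + k) = 0] over [k^2 + AB + BC + CA = 4n].  With
    [r = (A - k) / 2], [P = (A + B) / 2], [T = (A + C) / 2] the equation is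
    [PT = n - r^2 + r A] and the summand is [4 r (P - r)].  For [r = R] and
    [r = -R] the admissible [(P, T)] are the two kinds of corners of staircases
    of step [2R] that follow the hyperbola [PT = n - R^2], and [P - r] is the
    abscissa of the corner: the sum telescopes. *)

Local Notation odz x := (2 * x + 1).

(** * Finite sums over boxes of integers *)

Lemma big_seq_bij (I J : eqType) (s : seq I) (t : seq J) (P : pred I)
    (Q : pred J) (f : I -> J) (g : J -> I) (F : J -> int) :
  uniq s -> uniq t ->
  (forall x, x \in s -> P x -> [/\ f x \in t, Q (f x) & g (f x) = x]) ->
  (forall y, y \in t -> Q y -> [/\ g y \in s, P (g y) & f (g y) = y]) ->
  \sum_(y <- t | Q y) F y = \sum_(x <- s | P x) F (f x).
Proof.
move=> us ut fP gQ; rewrite -[LHS]big_filter -[RHS]big_filter.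
rewrite -(big_map f xpredT F); apply: perm_big; apply: uniq_perm.
- exact: filter_uniq.
- rewrite map_inj_in_uniq ?filter_uniq// => x y.
  rewrite !mem_filter => /andP[Px xs] /andP[Py ys] fxy.
  by have [_ _ <-] := fP _ xs Px; have [_ _ <-] := fP _ ys Py; rewrite fxy.
- move=> y; rewrite mem_filter; apply/andP/mapP.
    move=> [Qy yt]; have [gs Pg <-] := gQ _ yt Qy.
    by exists (g y) => //; rewrite mem_filter Pg.
  by move=> [x]; rewrite mem_filter => /andP[Px xs] ->; have [] := fP _ xs Px.
Qed.

Definition zball (M : nat) : seq int := [seq i%:Z - M%:Z | i <- iota 0 M.*2.+1].
Definition zpos (K : nat) : seq int := [seq i.+1%:Z | i <- iota 0 K].

Lemma mem_zball M x : (x \in zball M) = (- M%:Z <= x <= M%:Z).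
Proof.
apply/mapP/idP => [[i]|xM]; first by rewrite mem_iota => ? ->; lia.
by exists (absz (x + M%:Z)); rewrite ?mem_iota; lia.
Qed.

Lemma zball_uniq M : uniq (zball M).
Proof. by rewrite map_inj_uniq ?iota_uniq// => i j; lia. Qed.

Lemma mem_zpos K x : (x \in zpos K) = (0 < x <= K%:Z).
Proof.
apply/mapP/idP => [[i]|xM]; first by rewrite mem_iota => ? ->; lia.
by exists (absz x).-1; rewrite ?mem_iota; lia.
Qed.

Lemma zpos_uniq K : uniq (zpos K).
Proof. by rewrite map_inj_uniq ?iota_uniq// => i j; lia. Qed.

Lemma big_zpos K (h : int -> int) :
  \sum_(x <- zpos K) h x = \sum_(i < K) h i.+1%:Z.
Proof.
rewrite big_map -(big_mkord xpredT (fun i => h i.+1%:Z)).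
by rewrite /index_iota subn0.
Qed.

Definition quad := ((int * int) * (int * int))%type.
Definition box4 (s1 s2 s3 s4 : seq int) : seq quad :=
  [seq (x, y) | x <- [seq (x, y) | x <- s1, y <- s2],
                y <- [seq (x, y) | x <- s3, y <- s4]].

Lemma mem_box4 s1 s2 s3 s4 x1 x2 x3 x4 :
  ((x1, x2, (x3, x4)) \in box4 s1 s2 s3 s4) =
  [&& x1 \in s1, x2 \in s2, x3 \in s3 & x4 \in s4].
Proof.
have mem2 (T1 T2 : eqType) (u : seq T1) (v : seq T2) x y :
    ((x, y) \in [seq (a, b) | a <- u, b <- v]) = (x \in u) && (y \in v).
  apply/allpairsP/andP => [[[a b] /= [au bv [-> ->]]]//|[xu yv]].
  by exists (x, y).
by rewrite !mem2 -!andbA.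
Qed.

Lemma box4_uniq s1 s2 s3 s4 :
  uniq s1 -> uniq s2 -> uniq s3 -> uniq s4 -> uniq (box4 s1 s2 s3 s4).
Proof.
have inj (T1 T2 : Type) : injective (fun x : T1 * T2 => (x.1, x.2)).
  by move=> [? ?] [? ?] [-> ->].
move=> *; do 3?apply: allpairs_uniq => //; move=> [? ?] [? ?] _ _ /= [-> ->]//.
Qed.

Lemma big_box4 s1 s2 s3 s4 (p : pred quad) (F : quad -> int) :
  \sum_(q <- box4 s1 s2 s3 s4 | p q) F q =
  \sum_(x1 <- s1) \sum_(x2 <- s2) \sum_(x3 <- s3) \sum_(x4 <- s4)
    (if p (x1, x2, (x3, x4)) then F (x1, x2, (x3, x4)) else 0).
Proof.
rewrite big_mkcond /box4 big_allpairs big_allpairs.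
apply: eq_bigr => x1 _; apply: eq_bigr => x2 _.
by rewrite big_allpairs.
Qed.

(** * Shifted, telescoping, periodic and antisymmetric sums *)

Lemma shift_sum (K q : nat) (h : int -> int) :
  (forall x, x <= 0 -> h x = 0) ->
  \sum_(i < q + K) h (i.+1%:Z - q%:Z) = \sum_(i < K) h i.+1%:Z.
Proof.
move=> h0; rewrite big_split_ord /= big1 ?add0r; last first.
  by move=> i _; apply: h0; have := ltn_ord i; lia.
by apply: eq_bigr => i _; congr h; lia.
Qed.

Lemma telescope_step (K q : nat) (h : int -> int) :
  (forall x, x <= 0 -> h x = 0) ->
  \sum_(i < q + K) (h i.+1%:Z - h (i.+1%:Z - q%:Z)) =
  \sum_(i < q) h (K%:Z + i.+1%:Z).
Proof.
move=> h0; rewrite sumrB shift_sum// addnC big_split_ord /= addrAC subrr add0r.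
by apply: eq_bigr => i _; congr h; lia.
Qed.

Lemma periodic_sum (K q : nat) (h : int -> int) :
  (forall x, h (x + q%:Z) = h x) ->
  \sum_(i < q) h (K%:Z + i.+1%:Z) = \sum_(i < q) h i.+1%:Z.
Proof.
move=> hq; elim: K => [|K <-]; first by apply: eq_bigr => i _; rewrite add0r.
case: q hq => [|q] hq; first by rewrite !big_ord0.
rewrite big_ord_recr [RHS]big_ord_recl /= addrC; congr (_ + _).
  by rewrite -[RHS]hq; congr h; rewrite /=; lia.
by apply: eq_bigr => i _; congr h; rewrite /bump /=; lia.
Qed.

(** Reversing both indices, [x] to [m.+1 - x], preserves [v] and changes the sign of [x - c], so the
    sum equals its opposite. *)
Lemma reflection_sum (m : nat) (c : int) (v : int -> int -> int) :
  c *+ 2 = m.+1%:Z ->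
  (forall x y, v (m.+1%:Z - x) (m.+1%:Z - y) = v x y) ->
  \sum_(i < m) \sum_(j < m) (i.+1%:Z - c) * v i.+1%:Z j.+1%:Z = 0.
Proof.
move=> cm vE; set s := LHS.
suff : s = - s by lia.
rewrite {1}/s (reindex_inj rev_ord_inj) /= /s -sumrN; apply: eq_bigr => i _.
rewrite (reindex_inj rev_ord_inj) /= -sumrN; apply: eq_bigr => j _.
have -> : (m - i.+1).+1%:Z = m.+1%:Z - i.+1%:Z by have := ltn_ord i; lia.
have -> : (m - j.+1).+1%:Z = m.+1%:Z - j.+1%:Z by have := ltn_ord j; lia.
by rewrite vE -mulNr -cm; congr (_ * _); ring.
Qed.

(** * Corners of staircases along a hyperbola *)

Section Staircase.
Variables (R : nat) (nu : int).
Hypothesis R0 : (0 < R)%N.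
Hypothesis odd_nuR : (2 %| nu + R%:Z + 1)%Z.

(* [lat] selects the [(P, T)] with [P * T = nu + R * A] for some odd [A]. *)
Definition lat (P T : int) : bool := ((2 * R%:Z) %| P * T - nu - R%:Z)%Z.

(** Writing [P * T = nu + R * A] for [outer] and [P * T = nu - R * A] for [inner], with [A] odd, the
    inequalities say [0 < A], [A < 2 * T] and [A < 2 * P], that is, [A], [B] and [C] are
    positive. *)
Definition outer (P T : int) : bool :=
  [&& lat P T, nu < P * T, (P - 2 * R%:Z) * T < nu & P * (T - 2 * R%:Z) < nu].
Definition inner (P T : int) : bool :=
  [&& lat P T, P * T < nu, nu < (P + 2 * R%:Z) * T & nu < P * (T + 2 * R%:Z)].

Lemma lat_shiftr P T z : lat P (T + 2 * R%:Z * z) = lat P T.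
Proof.
rewrite /lat; have -> : P * (T + 2 * R%:Z * z) - nu - R%:Z =
  P * z * (2 * R%:Z) + (P * T - nu - R%:Z) by ring.
by rewrite rpredDl //; apply: dvdz_mull.
Qed.

Lemma lat_sym P T : lat P T = lat T P.
Proof. by rewrite /lat mulrC. Qed.

Lemma lat_shiftl P T z : lat (P + 2 * R%:Z * z) T = lat P T.
Proof. by rewrite lat_sym lat_shiftr lat_sym. Qed.

Lemma lat_reflect P T : lat (2 * R%:Z - P) (2 * R%:Z - T) = lat P T.
Proof.
have -> : 2 * R%:Z - P = - P + 2 * R%:Z * 1 by ring.
have -> : 2 * R%:Z - T = - T + 2 * R%:Z * 1 by ring.
by rewrite lat_shiftl lat_shiftr /lat mulrNN.
Qed.

(** By [odd_nuR], [nu + R] is odd, whereas the divisibility would make it even. *)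
Lemma lat_edge T : lat (2 * R%:Z) T = false.
Proof. apply/negP => /dvdzP[z]; move/dvdzP: odd_nuR => [y] yE zE.
have : 2 * (R%:Z * T - z * R%:Z - y + 1) = 1 by lia.
lia. Qed.

(** [P * T - nu] is an odd multiple of [R]: no point of the lattice lies on the hyperbola. *)
Lemma lat_neq P T : lat P T -> P * T != nu.
Proof. move=> /dvdzP[z e]; apply/eqP => h.
have /eqP : R%:Z * (2 * z + 1) = 0 by lia.
by rewrite mulf_eq0; lia. Qed.

Definition above (P T : int) : bool := [&& 0 < P, 0 < T & nu < P * T].

(* The second difference of the indicator function of the region above the
   hyperbola is 1 at outer corners, -1 at inner ones and 0 elsewhere. *)
Lemma corner_second_difference P T : 0 <= nu -> 0 < P -> 0 < T ->
  (outer P T)%:R - [&& 0 < P - 2 * R%:Z, 0 < T - 2 * R%:Z &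
                   inner (P - 2 * R%:Z) (T - 2 * R%:Z)]%:R =
  (lat P T)%:R * ((above P T)%:R - (above (P - 2 * R%:Z) T)%:R -
     ((above P (T - 2 * R%:Z))%:R
       - (above (P - 2 * R%:Z) (T - 2 * R%:Z))%:R)) :> int.
Proof.
move=> nu0 P0 T0; rewrite /outer /inner.
have l1 : lat (P - 2 * R%:Z) T = lat P T.
  by rewrite -(lat_shiftl P T (-1)); congr lat; ring.
have l2 x : lat x (T - 2 * R%:Z) = lat x T.
  by rewrite -(lat_shiftr x T (-1)); congr lat; ring.
rewrite !l2 l1; case: (boolP (lat P T)) => [lPT|_]; last first.
  by rewrite /= !andbF mul0r subrr.
have n0 := lat_neq lPT.
have n1 : (P - 2 * R%:Z) * T != nu by apply: lat_neq; rewrite l1.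
have n2 : P * (T - 2 * R%:Z) != nu by apply: lat_neq; rewrite l2.
have n3 : (P - 2 * R%:Z) * (T - 2 * R%:Z) != nu.
  by apply: lat_neq; rewrite l2 l1.
rewrite /above mul1r P0 T0 /= !subrK.
set Q := P - 2 * R%:Z in n1 n3 *; set U := T - 2 * R%:Z in n2 n3 *.
have QP : Q < P by rewrite /Q; lia.
have UT : U < T by rewrite /U; lia.
have h1 : Q * T < P * T by rewrite ltr_pM2r.
have h2 : P * U < P * T by rewrite ltr_pM2l.
(* A nonpositive [Q] or [U] makes its product with [T] or [P] nonpositive, hence at most [nu]. *)
case: (ltP 0 Q) => Q0; case: (ltP 0 U) => U0 /=.
- have h3 : Q * U < P * U by rewrite ltr_pM2r.
  have h4 : Q * U < Q * T by rewrite ltr_pM2l.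
  rewrite /Q/U in n0 n1 n2 n3 h1 h2 h3 h4 *; lia.
- have h3 : P * U <= 0 by nia.
  lia.
- have h3 : Q * T <= 0 by nia.
  lia.
- have h3 : P * U <= 0 by nia.
  have h4 : Q * T <= 0 by nia.
  lia.
Qed.

(** Row and column [2 * R] are empty by [lat_edge]; the remaining square, with indices from 1 to
    [2 * R - 1], is symmetric about [R]. *)
Lemma lat_reflection_sum (v : int -> int -> bool) :
  (forall x y, v (2 * R%:Z - x) (2 * R%:Z - y) = v x y) ->
  \sum_(i < R.*2) \sum_(j < R.*2) (i.+1%:Z - R%:Z) *
    (lat i.+1%:Z j.+1%:Z && v i.+1%:Z j.+1%:Z)%:R = 0.
Proof.
move=> vE; have -> : R.*2 = R.*2.-1.+1 by lia.
have e1 : 2 * R%:Z = R.*2.-1.+1%:Z by lia.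
rewrite big_ord_recr /= addrC big1 ?add0r; last first.
  by move=> j _; rewrite -e1 lat_edge mulr0.
under eq_bigr => i _.
  rewrite big_ord_recr /= -e1 lat_sym lat_edge mulr0 addr0; over.
apply: (reflection_sum (v := fun x y => (lat x y && v x y)%:R)) => [|x y].
  by lia.
by rewrite -!e1 lat_reflect vE.
Qed.

(** For [nu < 0] there are no inner corners, and the outer ones lie in the square of side [2 * R]
    and are symmetric. Otherwise, moving the inner corners by [(2 * R, 2 * R)] turns their weight
    [P + R] into [P - R]; the second difference then telescopes in [T], and what is left at the far
    end vanishes by reflection. *)
Lemma corner_sum (K : nat) : nu < K%:Z ->
  \sum_(i < R.*2 + K) \sum_(j < R.*2 + K)
    ((i.+1%:Z - R%:Z) * (outer i.+1%:Z j.+1%:Z)%:R -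
     (i.+1%:Z + R%:Z) * (inner i.+1%:Z j.+1%:Z)%:R) = 0.
Proof.
move=> nuK; have e2 : 2 * R%:Z = R.*2%:Z by lia.
have [nu0|nu0] := leP 0 nu; last first.
  pose v x y := ((x - 2 * R%:Z) * y < nu) && (x * (y - 2 * R%:Z) < nu).
  rewrite -[RHS](@lat_reflection_sum v); last first.
    move=> x y; rewrite /v andbC; congr (_ && _); congr (_ < _); ring.
  have inner0 i j : inner i.+1%:Z j.+1%:Z = false.
    by apply/negP => /and4P[_]; nia.
  rewrite big_split_ord /= [X in _ + X]big1 ?addr0; last first.
    move=> i _; apply: big1 => j _; rewrite inner0 mulr0 subr0.
    suff -> : outer (R.*2 + i).+1%:Z j.+1%:Z = false by rewrite mulr0.
    by apply/negP => /and4P[_ _ + _]; nia.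
  apply: eq_bigr => i _; rewrite big_split_ord /= [X in _ + X]big1 ?addr0.
    apply: eq_bigr => j _; rewrite inner0 mulr0 subr0 /outer /v.
    by congr (_ * (_ && _)%:R); have -> : nu < i.+1%:Z * j.+1%:Z by nia.
  move=> j _; rewrite inner0 mulr0 subr0.
  suff -> : outer i.+1%:Z (R.*2 + j).+1%:Z = false by rewrite mulr0.
  by apply/negP => /and4P[_ _ _]; nia.
pose w (x y : int) := (x + R%:Z) * [&& 0 < x, 0 < y & inner x y]%:R.
have wE : \sum_(i < R.*2 + K) \sum_(j < R.*2 + K)
      (i.+1%:Z + R%:Z) * (inner i.+1%:Z j.+1%:Z)%:R =
    \sum_(i < R.*2 + K) \sum_(j < R.*2 + K)
      w (i.+1%:Z - R.*2%:Z) (j.+1%:Z - R.*2%:Z).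
  pose h x := \sum_(j < K) w x j.+1%:Z.
  have w0 x y : (x <= 0) || (y <= 0) -> w x y = 0.
    by move=> xy; rewrite /w; case: and3P => [[]|_]; rewrite ?mulr0//; lia.
  transitivity (\sum_(i < R.*2 + K) h (i.+1%:Z - R.*2%:Z)); last first.
    apply: eq_bigr => i _; rewrite (@shift_sum K _ (w _))// => y y0.
    by rewrite w0// y0 orbT.
  rewrite shift_sum; last by move=> x x0; apply: big1 => j _; rewrite w0// x0.
  (* An inner corner satisfies [P * T < nu < K], so the sum over [K] indices already contains them
     all. *)
  have far i j : (K <= i)%N || (K <= j)%N -> inner i.+1%:Z j.+1%:Z = false.
    by move=> ij; apply/negP => /and4P[_ + _ _]; nia.
  rewrite addnC big_split_ord /= [X in _ + X]big1 ?addr0; last first.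
    by move=> i _; apply: big1 => j _; rewrite far ?mulr0// leq_addr.
  apply: eq_bigr => i _; rewrite big_split_ord /= [X in _ + X]big1 ?addr0//.
  by move=> j _; rewrite far ?mulr0// leq_addr orbT.
under eq_bigr do rewrite sumrB.
rewrite sumrB wE -sumrB.
pose h (x y : int) : int :=
  (lat x y)%:R * ((above x y)%:R - (above (x - 2 * R%:Z) y)%:R).
have colE (i : nat) :
    \sum_(j < R.*2 + K) (i.+1%:Z - R%:Z) * (outer i.+1%:Z j.+1%:Z)%:R -
    \sum_(j < R.*2 + K) w (i.+1%:Z - R.*2%:Z) (j.+1%:Z - R.*2%:Z) =
  (i.+1%:Z - R%:Z) * \sum_(j < R.*2) h i.+1%:Z (K%:Z + j.+1%:Z).
  rewrite -(@telescope_step K _ (h i.+1%:Z)); last first.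
    move=> y y0; rewrite /h /above; have -> : (0 < y) = false by lia.
    by rewrite !andbF subrr mulr0.
  rewrite -sumrB mulr_sumr; apply: eq_bigr => j _.
  have -> : h i.+1%:Z j.+1%:Z - h i.+1%:Z (j.+1%:Z - R.*2%:Z) =
    (outer i.+1%:Z j.+1%:Z)%:R - [&& 0 < i.+1%:Z - 2 * R%:Z,
       0 < j.+1%:Z - 2 * R%:Z &
       inner (i.+1%:Z - 2 * R%:Z) (j.+1%:Z - 2 * R%:Z)]%:R.
    rewrite corner_second_difference// /h -e2.
    have -> : lat i.+1%:Z (j.+1%:Z - 2 * R%:Z) = lat i.+1%:Z j.+1%:Z.
      by rewrite -(lat_shiftr _ j.+1%:Z (-1)); congr lat; ring.
    by rewrite -mulrBr.
  by rewrite /w -e2 mulrBr; congr (_ - _); congr (_ * _); ring.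
under eq_bigr do rewrite colE.
rewrite -[RHS](@lat_reflection_sum (fun _ _ => true))//.
(* Beyond [T = K] every point with [P > 0] is above the hyperbola, so the first difference in [P]
   survives only for [P <= 2 * R], where it is the indicator of [lat], periodic in [T]. *)
have above_far (i j : nat) : above i.+1%:Z (K%:Z + j.+1%:Z).
  by rewrite /above; apply/and3P; split; nia.
rewrite big_split_ord /= [X in _ + X]big1 ?addr0; last first.
  move=> i _; rewrite big1 ?mulr0// => j _; rewrite /h above_far.
  have -> : (R.*2 + i).+1%:Z - 2 * R%:Z = i.+1%:Z by lia.
  by rewrite above_far subrr mulr0.
apply: eq_bigr => i _; rewrite -mulr_sumr; congr (_ * _).
transitivity (\sum_(j < R.*2) (lat i.+1%:Z (K%:Z + j.+1%:Z))%:R : int).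
  apply: eq_bigr => j _; rewrite /h above_far.
  have -> : above (i.+1%:Z - 2 * R%:Z) (K%:Z + j.+1%:Z) = false.
    by apply/negbTE/and3P => -[]; have := ltn_ord i; lia.
  by rewrite subr0 mulr1.
rewrite (@periodic_sum K _ (fun y => (lat i.+1%:Z y)%:R)).
  by apply: eq_bigr => j _; rewrite andbT.
move=> y; have -> : y + R.*2%:Z = y + 2 * R%:Z * 1 by lia.
by rewrite lat_shiftr.
Qed.

End Staircase.

(** * From solutions of [k^2 + AB + BC + CA = 4n] to corners *)

Lemma mul_succ_even (k : int) : exists z : int, k * (k + 1) = 2 * z.
Proof.
have [j [->|->]] : exists j : int, k = 2 * j \/ k = odz j.
- by exists (k %/ 2)%Z; lia.
- by exists (j * odz j); ring.
- by exists (odz j * (j + 1)); ring.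
Qed.

(** The [reflect] premise fits [outerP] and [innerP]: since [P], [T] and [R] determine [a], the sum
    over [a] becomes the indicator of a corner. *)
Lemma sum_unique (s : seq int) (p : pred int) (w : int) (b : bool) :
  uniq s -> (forall x y, p x -> p y -> x = y) ->
  reflect (exists2 x, x \in s & p x) b ->
  \sum_(x <- s) (if p x then w else 0) = w * b%:R.
Proof.
move=> us pu; case=> [[x xs px]|np].
  rewrite (bigD1_seq x)//= px big1 ?addr0 ?mulr1// => y /eqP yx.
  by case: ifP => // py; have := pu _ _ py px.
by rewrite big1_seq ?mulr0// => x xs; case: ifP => // px; case: np; exists x.
Qed.

Lemma outerP (R : nat) (nu P T : int) (K : nat) : (0 < R)%N -> P <= K%:Z ->
  reflect (exists2 a, a \in zball K & [&& 0 <= a, a < P, a < T &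
             P * T == nu + R%:Z * odz a])
    (outer R nu P T).
Proof.
move=> R0 PK; have R0' : 0 < R%:Z by lia.
apply: (iffP and4P) => [[/dvdzP[z zE] h1 h2 h3]|[a _ /and4P[a0 aP aT /eqP e]]].
  have e : P * T = nu + R%:Z * odz z by lia.
  have z0 : 0 < odz z by rewrite -(pmulr_rgt0 _ R0'); lia.
  have zT : odz z < 2 * T by rewrite -(ltr_pM2l R0'); lia.
  have zP : odz z < 2 * P by rewrite -(ltr_pM2l R0'); lia.
  by exists z; [rewrite mem_zball; lia|rewrite e eqxx; lia].
split; first by apply/dvdzP; exists a; lia.
- by rewrite e ltrDl mulr_gt0//; lia.
- have : R%:Z * odz a < R%:Z * (2 * T) by rewrite ltr_pM2l//; lia.
  lia.
- have : R%:Z * odz a < R%:Z * (2 * P) by rewrite ltr_pM2l//; lia.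
  lia.
Qed.

Lemma innerP (R : nat) (nu P T : int) (K : nat) : (0 < R)%N -> P <= K%:Z ->
  reflect (exists2 a, a \in zball K & [&& 0 <= a, a < P, a < T &
             P * T == nu - R%:Z * odz a])
    (inner R nu P T).
Proof.
move=> R0 PK; have R0' : 0 < R%:Z by lia.
apply: (iffP and4P) => [[/dvdzP[z zE] h1 h2 h3]|[a _ /and4P[a0 aP aT /eqP e]]].
  have e : P * T = nu - R%:Z * odz (-1 - z) by lia.
  have z0 : 0 < odz (-1 - z) by rewrite -(pmulr_rgt0 _ R0'); lia.
  have zT : odz (-1 - z) < 2 * T by rewrite -(ltr_pM2l R0'); lia.
  have zP : odz (-1 - z) < 2 * P by rewrite -(ltr_pM2l R0'); lia.
  by exists (-1 - z); [rewrite mem_zball; lia|rewrite -e eqxx; lia].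
split; first by apply/dvdzP; exists (- 1 - a); lia.
- by rewrite e ltrBlDr ltrDl mulr_gt0//; lia.
- have : R%:Z * odz a < R%:Z * (2 * T) by rewrite ltr_pM2l//; lia.
  lia.
- have : R%:Z * odz a < R%:Z * (2 * P) by rewrite ltr_pM2l//; lia.
  lia.
Qed.

(* [tri] and the predicates below are about odd integers [odz k], [odz a], ...,
   which are given by their halves. *)
Definition tri (n : nat) (q : quad) : bool :=
  let: (k, a, (b, c)) := q in
  [&& 0 <= a, 0 <= b, 0 <= c &
      odz k ^+ 2 + (odz a * odz b + odz b * odz c + odz c * odz a)
      == 4 * n%:Z].

Lemma tri_bounds n k a b c : tri n (k, a, (b, c)) ->
  [/\ - (4 * n%:Z) <= k <= 4 * n%:Z, 0 <= a <= 4 * n%:Z, 0 <= b <= 4 * n%:Z &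
     0 <= c <= 4 * n%:Z].
Proof.
move=> /and4P[a0 b0 c0 /eqP e].
have h1 : 0 <= a * b by apply: mulr_ge0.
have h2 : 0 <= b * c by apply: mulr_ge0.
have h3 : 0 <= c * a by apply: mulr_ge0.
have h4 : k <= k * k by nia.
have h5 : - 2 * k - 1 <= k * k by have := sqr_ge0 (k + 1); lia.
have h6 : 0 <= k * k + k by nia.
have {e} : 4 * (k * k + k) + 4 * (a * b + b * c + c * a + a + b + c + 1) =
  4 * n%:Z by rewrite -e; ring.
by split; lia.
Qed.

(** In halves, the summand is a quarter of [(A - k) * (B + k)]. Terms with [a = k] vanish; the
    others are split by the sign of [a - k] and reindexed by [R = |a - k|], [P = a + b + 1],
    [T = a + c + 1], which gives a sum over corners for each [R]. *)
Lemma tri_telescope (n M : nat) : odd n -> (4 * n <= M)%N ->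
  \sum_(q <- box4 (zball M) (zball M) (zball M) (zball M) | tri n q)
    (let: (k, a, (b, c)) := q in (a - k) * (b + 1 + k)) = 0.
Proof.
move=> n_odd nM; set B := box4 _ _ _ _.
have uB : uniq B by apply: box4_uniq; apply: zball_uniq.
(* [K1] bounds [|a - k|], and [K - 2 * R] still exceeds [n], hence [nu R], as [corner_sum]
   requires. *)
pose K1 := (2 * M)%N; pose K := (2 * K1 + n.+1)%N.
pose B' := box4 (zpos K1) (zpos K) (zpos K) (zball K).
have uB' : uniq B' by apply: box4_uniq; rewrite ?zball_uniq ?zpos_uniq.
pose rsub (q : quad) := let: (k, a, (b, c)) := q in a - k.
rewrite (bigID (fun q => 0 < rsub q)) /=.
rewrite [X in _ + X](bigID (fun q => rsub q == 0)) /=.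
rewrite [X in _ + (X + _)]big1 ?add0r; last first.
  by move=> [[k a] [b c]] /andP[_ /eqP] /= ->; rewrite mul0r.
pose nu (R : int) : int := n%:Z - R ^+ 2.
pose Qp (q : quad) := let: (R, P, (T, a)) := q in
  [&& 0 <= a, a < P, a < T & P * T == nu R + R * odz a].
pose Qn (q : quad) := let: (R, P, (T, a)) := q in
  [&& 0 <= a, a < P, a < T & P * T == nu R - R * odz a].
pose Fp (q : quad) := let: (R, P, (T, a)) := q in R * (P - R).
pose Fn (q : quad) := let: (R, P, (T, a)) := q in - (R * (P + R)).
have -> : \sum_(q <- B | tri n q && (0 < rsub q))
    (let: (k, a, (b, c)) := q in (a - k) * (b + 1 + k)) =
    \sum_(q <- B' | Qp q) Fp q.
  rewrite [RHS](@big_seq_bij _ _ B _ (fun q => tri n q && (0 < rsub q)) _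
   (fun q => let: (k, a, (b, c)) := q in (a - k, a + b + 1, (a + c + 1, a)))
   (fun q => let: (R, P, (T, a)) := q in (a - R, a, (P - 1 - a, T - 1 - a))))//.
  - by apply: eq_bigr => -[[k a] [b c]] _; rewrite /Fp; congr (_ * _); lia.
  - move=> [[k a] [b c]] _ /andP[t r]; have [hk ha hb hc] := tri_bounds t.
    move: t r; rewrite /Qp /B' mem_box4 !mem_zpos !mem_zball /nu /=.
    move=> /and4P[a0 b0 c0 e] r; split; [lia| |congr (_, _, (_, _)); lia].
    apply/and4P; split; lia.
  - move=> [[R P] [T a]]; rewrite mem_box4 !mem_zpos mem_zball /Qp.
    move=> h /and4P[a0 aP aT e].
    have t : tri n (a - R, a, (P - 1 - a, T - 1 - a)).
      by apply/and4P; split; rewrite /nu in e; lia.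
    have [hk ha hb hc] := tri_bounds t.
    rewrite t /B mem_box4 !mem_zball /=; split; [lia|lia|].
    congr (_, _, (_, _)); lia.
have -> : \sum_(q <- B | tri n q && ~~ (0 < rsub q) && (rsub q != 0))
    (let: (k, a, (b, c)) := q in (a - k) * (b + 1 + k)) =
    \sum_(q <- B' | Qn q) Fn q.
  rewrite [RHS](@big_seq_bij _ _ B _
     (fun q => tri n q && ~~ (0 < rsub q) && (rsub q != 0)) _
   (fun q => let: (k, a, (b, c)) := q in (k - a, a + b + 1, (a + c + 1, a)))
   (fun q => let: (R, P, (T, a)) := q in (a + R, a, (P - 1 - a, T - 1 - a))))//.
  - by apply: eq_bigr => -[[k a] [b c]] _; rewrite /Fn; ring.
  - move=> [[k a] [b c]] _ /andP[/andP[t r] r'].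
    have [hk ha hb hc] := tri_bounds t.
    move: t r r'; rewrite /Qn /B' mem_box4 !mem_zpos !mem_zball /nu /=.
    move=> /and4P[a0 b0 c0 e] r r'; split; [lia| |congr (_, _, (_, _)); lia].
    apply/and4P; split; lia.
  - move=> [[R P] [T a]]; rewrite mem_box4 !mem_zpos mem_zball /Qn.
    move=> h /and4P[a0 aP aT e].
    have t : tri n (a + R, a, (P - 1 - a, T - 1 - a)).
      by apply/and4P; split; rewrite /nu in e; lia.
    have [hk ha hb hc] := tri_bounds t.
    rewrite t /B mem_box4 !mem_zball /=; split; [lia|lia|].
    congr (_, _, (_, _)); lia.
rewrite !big_box4 -big_split /= big_zpos big1// => i _.
have iK1 := ltn_ord i.
rewrite -big_split /= big_zpos.
transitivity (i.+1%:Z * \sum_(P < K) \sum_(T < K)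
    ((P.+1%:Z - i.+1%:Z) * (outer i.+1 (nu i.+1%:Z) P.+1%:Z T.+1%:Z)%:R -
     (P.+1%:Z + i.+1%:Z) * (inner i.+1 (nu i.+1%:Z) P.+1%:Z T.+1%:Z)%:R)).
  rewrite mulr_sumr; apply: eq_bigr => P _.
  rewrite -big_split /= big_zpos mulr_sumr; apply: eq_bigr => T _.
  have PK : P.+1%:Z <= K%:Z by have := ltn_ord P; lia.
  have inj x y : i.+1%:Z * odz x = i.+1%:Z * odz y -> x = y.
    by move/(mulfI (_ : i.+1%:Z != 0)); lia.
  rewrite (sum_unique _ (zball_uniq K) _
    (outerP (nu i.+1%:Z) T.+1%:Z (ltn0Sn i) PK)).
    rewrite (sum_unique _ (zball_uniq K) _
      (innerP (nu i.+1%:Z) T.+1%:Z (ltn0Sn i) PK)).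
      by ring.
    by move=> x y /and4P[_ _ _ /eqP hx] /and4P[_ _ _ /eqP hy]; apply: inj; lia.
  by move=> x y /and4P[_ _ _ /eqP hx] /and4P[_ _ _ /eqP hy]; apply: inj; lia.
have -> : K = (i.+1.*2 + (K - i.+1.*2))%N by rewrite /K; lia.
rewrite corner_sum ?mulr0//.
(* With [R = i + 1], [nu + R + 1 = n + 1 - i * (i + 1)] is even because [n] is odd. *)
- have [z zE] := mul_succ_even i%:Z.
  apply/dvdzP; exists (n./2%:Z + 1 - z); rewrite /nu.
  by have := odd_double_half n; lia.
- by rewrite /nu; have := sqr_ge0 i.+1%:Z; lia.
Qed.

(** * Second moments by symmetry *)

Definition zcube4 (M : nat) := box4 (zball M) (zball M) (zball M) (zball M).

Lemma zcube4_uniq M : uniq (zcube4 M).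
Proof. by apply: box4_uniq; apply: zball_uniq. Qed.

Lemma sum_zcube4_invol M (p : pred quad) (f : quad -> quad) (F : quad -> int) :
  involutive f ->
  (forall q, q \in zcube4 M -> f q \in zcube4 M) ->
  (forall q, p q -> p (f q)) ->
  \sum_(q <- zcube4 M | p q) F q = \sum_(q <- zcube4 M | p q) F (f q).
Proof.
move=> fK fM fp; apply: (big_seq_bij (g := f)); rewrite ?zcube4_uniq//.
  by move=> q qM pq; rewrite fK fM ?fp.
by move=> q qM pq; rewrite fK fM ?fp.
Qed.

(** Exchanging [a] and [b] cancels the mixed terms [kA - kB] of [tri_telescope], so [AB] and [k^2]
    have the same sum. By symmetry [BC] and [CA] share it too, and the four add up to [4n] in each
    term. *)
Lemma tri_moment (n M : nat) : odd n -> (4 * n <= M)%N ->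
  \sum_(q <- zcube4 M | tri n q)
    (let: (k, a, (b, c)) := q in odz k ^+ 2 - n%:Z) = 0.
Proof.
move=> n_odd nM.
pose swab (q : quad) := let: (k, a, (b, c)) := q in (k, b, (a, c)).
pose swbc (q : quad) := let: (k, a, (b, c)) := q in (k, a, (c, b)).
have swabE F := @sum_zcube4_invol M (tri n) swab F.
have swbcE F := @sum_zcube4_invol M (tri n) swbc F.
pose sq (q : quad) := let: (k, a, (b, c)) := q in odz k ^+ 2.
pose ab (q : quad) := let: (k, a, (b, c)) := q in odz a * odz b.
pose bc (q : quad) := let: (k, a, (b, c)) := q in odz b * odz c.
pose ca (q : quad) := let: (k, a, (b, c)) := q in odz c * odz a.
pose mix (q : quad) := let: (k, a, (b, c)) := q in odz k * odz a.
pose mix' (q : quad) := let: (k, a, (b, c)) := q in odz k * odz b.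
have swab_h : (forall q, q \in zcube4 M -> swab q \in zcube4 M) /\
    (forall q, tri n q -> tri n (swab q)).
  split => -[[k a] [b c]]; rewrite ?mem_box4 /swab /=.
    by move=> /and4P[-> -> -> ->].
  by move=> /and4P[? ? ? ?]; apply/and4P; split => //; lia.
have swbc_h : (forall q, q \in zcube4 M -> swbc q \in zcube4 M) /\
    (forall q, tri n q -> tri n (swbc q)).
  split => -[[k a] [b c]]; rewrite ?mem_box4 /swbc /=.
    by move=> /and4P[-> -> -> ->].
  by move=> /and4P[? ? ? ?]; apply/and4P; split => //; lia.
have h1 : \sum_(q <- zcube4 M | tri n q) mix q =
    \sum_(q <- zcube4 M | tri n q) mix' q.
  rewrite swabE; [|by move=> [[? ?] [? ?]]|exact: swab_h.1|exact: swab_h.2].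
  by apply: eq_bigr => -[[? ?] [? ?]].
have h2 : \sum_(q <- zcube4 M | tri n q) bc q =
    \sum_(q <- zcube4 M | tri n q) ca q.
  rewrite swabE; [|by move=> [[? ?] [? ?]]|exact: swab_h.1|exact: swab_h.2].
  by apply: eq_bigr => -[[? ?] [? ?]] _; rewrite /= mulrC.
have h3 : \sum_(q <- zcube4 M | tri n q) ab q =
    \sum_(q <- zcube4 M | tri n q) ca q.
  rewrite swbcE; [|by move=> [[? ?] [? ?]]|exact: swbc_h.1|exact: swbc_h.2].
  by apply: eq_bigr => -[[? ?] [? ?]] _; rewrite /= mulrC.
have h4 : \sum_(q <- zcube4 M | tri n q) ab q =
    \sum_(q <- zcube4 M | tri n q) sq q.
  have : \sum_(q <- zcube4 M | tri n q) (ab q - sq q + (mix q - mix' q)) = 0.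
    rewrite -[RHS](mulr0 4) -[in RHS](tri_telescope n_odd nM) mulr_sumr.
    by apply: eq_bigr => -[[k a] [b c]] _; rewrite /ab /sq /mix /mix'; ring.
  rewrite big_split /= !sumrB h1 subrr addr0 => /eqP.
  by rewrite subr_eq0 => /eqP.
suff : 4 * \sum_(q <- zcube4 M | tri n q)
    (let: (k, a, (b, c)) := q in odz k ^+ 2 - n%:Z) = 0 by lia.
transitivity (\sum_(q <- zcube4 M | tri n q)
  (sq q + (sq q + (sq q - ab q - bc q - ca q)))).
  rewrite mulr_sumr; apply: eq_bigr => -[[k a] [b c]] /and4P[_ _ _ /eqP e].
  by rewrite mulrBr -e /sq /ab /bc /ca; ring.
by rewrite !big_split /= !sumrN h2 h3 -h4 h3; ring.
Qed.

Definition four_sq (n : nat) (q : quad) : bool :=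
  let: (k, x, (y, z)) := q in
  odz k ^+ 2 + (odz x ^+ 2 + odz y ^+ 2 + odz z ^+ 2) == 4 * n%:Z.

(** Exchanging [k] with [x], [y] or [z] gives four equal sums, whose summands add up to 0. *)
Lemma four_sq_moment (n M : nat) :
  \sum_(q <- zcube4 M | four_sq n q)
    (let: (k, x, (y, z)) := q in odz k ^+ 2 - n%:Z) = 0.
Proof.
pose w1 (q : quad) := let: (k, x, (y, z)) := q in odz k ^+ 2 - n%:Z.
pose w2 (q : quad) := let: (k, x, (y, z)) := q in odz x ^+ 2 - n%:Z.
pose w3 (q : quad) := let: (k, x, (y, z)) := q in odz y ^+ 2 - n%:Z.
pose w4 (q : quad) := let: (k, x, (y, z)) := q in odz z ^+ 2 - n%:Z.
have h2 : \sum_(q <- zcube4 M | four_sq n q) w1 q =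
    \sum_(q <- zcube4 M | four_sq n q) w2 q.
  rewrite (@sum_zcube4_invol _ _
    (fun q => let: (k, x, (y, z)) := q in (x, k, (y, z)))).
  - by apply: eq_bigr => -[[? ?] [? ?]].
  - by move=> [[? ?] [? ?]].
  - by move=> [[? ?] [? ?]]; rewrite !mem_box4 => /and4P[-> -> -> ->].
  - by move=> [[? ?] [? ?]]; rewrite /four_sq; lia.
have h3 : \sum_(q <- zcube4 M | four_sq n q) w1 q =
    \sum_(q <- zcube4 M | four_sq n q) w3 q.
  rewrite (@sum_zcube4_invol _ _
    (fun q => let: (k, x, (y, z)) := q in (y, x, (k, z)))).
  - by apply: eq_bigr => -[[? ?] [? ?]].
  - by move=> [[? ?] [? ?]].
  - by move=> [[? ?] [? ?]]; rewrite !mem_box4 => /and4P[-> -> -> ->].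
  - by move=> [[? ?] [? ?]]; rewrite /four_sq; lia.
have h4 : \sum_(q <- zcube4 M | four_sq n q) w1 q =
    \sum_(q <- zcube4 M | four_sq n q) w4 q.
  rewrite (@sum_zcube4_invol _ _
    (fun q => let: (k, x, (y, z)) := q in (z, x, (y, k)))).
  - by apply: eq_bigr => -[[? ?] [? ?]].
  - by move=> [[? ?] [? ?]].
  - by move=> [[? ?] [? ?]]; rewrite !mem_box4 => /and4P[-> -> -> ->].
  - by move=> [[? ?] [? ?]]; rewrite /four_sq; lia.
change (\sum_(q <- zcube4 M | four_sq n q) w1 q = 0).
suff : \sum_(q <- zcube4 M | four_sq n q) (w1 q + (w2 q + (w3 q + w4 q))) = 0.
  rewrite !big_split /= -h2 -h3 -h4.
  by move: (\sum_(_ <- _ | _) _) => s; lia.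
apply: big1 => -[[k x] [y z]] /eqP e; rewrite /w1 /w2 /w3 /w4.
transitivity (4 * n%:Z - 4 * n%:Z); last exact: subrr.
by rewrite -{1}e; ring.
Qed.

(** * Sums of three odd squares *)

Definition tri3 (D a b c : int) : bool :=
  [&& 0 <= a, 0 <= b, 0 <= c &
      odz a * odz b + odz b * odz c + odz c * odz a == D].
Definition three_sq (D x y z : int) : bool :=
  odz x ^+ 2 + odz y ^+ 2 + odz z ^+ 2 == D.

(** With [three_sq D] and [tri3 D] these are the numbers [r(D)] and [g(D)], truncated to a box; they
    are integers because the recursions weigh them with both signs. *)
Definition count3 (M : nat) (p : int -> int -> int -> bool) : int :=
  \sum_(x <- zball M) \sum_(y <- zball M) \sum_(z <- zball M) (p x y z)%:R.

Lemma count3_gt0 M (p : int -> int -> int -> bool) x y z :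
  x \in zball M -> y \in zball M -> z \in zball M -> p x y z -> 0 < count3 M p.
Proof.
move=> xM yM zM pxyz; rewrite /count3.
have ge0 u v : 0 <= \sum_(w <- zball M) (p u v w)%:R :> int.
  by apply: sumr_ge0 => w _; exact: ler0n.
have ge0' u : 0 <= \sum_(v <- zball M) \sum_(w <- zball M) (p u v w)%:R :> int.
  by apply: sumr_ge0 => v _; exact: ge0.
rewrite (bigD1_seq x) ?zball_uniq//= ltr_wpDr ?sumr_ge0//.
rewrite (bigD1_seq y) ?zball_uniq//= ltr_wpDr ?sumr_ge0//.
by rewrite (bigD1_seq z) ?zball_uniq//= pxyz ltr_wpDr ?sumr_ge0.
Qed.

Lemma count3_eq0 M (p : int -> int -> int -> bool) :
  (forall x y z, ~~ p x y z) -> count3 M p = 0.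
Proof.
move=> np; rewrite /count3; apply: big1 => x _; apply: big1 => y _.
by apply: big1 => z _; rewrite (negbTE (np x y z)).
Qed.

Lemma tri_recursion (n M : nat) : odd n -> (4 * n <= M)%N ->
  \sum_(k <- zball M)
    (odz k ^+ 2 - n%:Z) * count3 M (tri3 (4 * n%:Z - odz k ^+ 2)) = 0.
Proof.
move=> n_odd nM; rewrite -[RHS](tri_moment n_odd nM) big_box4.
apply: eq_bigr => k _.
rewrite /count3 mulr_sumr; apply: eq_bigr => a _.
rewrite mulr_sumr; apply: eq_bigr => b _.
rewrite mulr_sumr; apply: eq_bigr => c _.
have -> : tri3 (4 * n%:Z - odz k ^+ 2) a b c = tri n (k, a, (b, c)).
  by rewrite /tri3 /tri; do 3![congr (_ && _)]; lia.
by case: (tri n _); rewrite ?mulr1 ?mulr0.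
Qed.

Lemma three_sq_recursion (n M : nat) :
  \sum_(k <- zball M)
    (odz k ^+ 2 - n%:Z) * count3 M (three_sq (4 * n%:Z - odz k ^+ 2)) = 0.
Proof.
rewrite -[RHS](four_sq_moment n M) big_box4; apply: eq_bigr => k _.
rewrite /count3 mulr_sumr; apply: eq_bigr => a _.
rewrite mulr_sumr; apply: eq_bigr => b _.
rewrite mulr_sumr; apply: eq_bigr => c _.
have -> : three_sq (4 * n%:Z - odz k ^+ 2) a b c = four_sq n (k, a, (b, c)).
  by rewrite /three_sq /four_sq; lia.
by case: (four_sq n _); rewrite ?mulr1 ?mulr0.
Qed.

(* The factors [count3 M (tri3 3)] and [count3 M (three_sq 3)] make the case
   [n = 1], where the recursion is void, trivial. *)
Lemma three_sq_tri3 (n M : nat) : odd n -> (4 * n <= M)%N ->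
  count3 M (three_sq (4 * n%:Z - 1)) * count3 M (tri3 3) =
  count3 M (three_sq 3) * count3 M (tri3 (4 * n%:Z - 1)).
Proof.
elim/ltn_ind: n => n IH n_odd nM.
pose d (D : int) := count3 M (three_sq D) * count3 M (tri3 3) -
                    count3 M (three_sq 3) * count3 M (tri3 D).
suff : d (4 * n%:Z - 1) = 0 by rewrite /d; lia.
have [n1|n1] := eqVneq n 1%N; first by rewrite n1 /d subrr.
have rec : \sum_(k <- zball M)
    (odz k ^+ 2 - n%:Z) * d (4 * n%:Z - odz k ^+ 2) = 0.
  transitivity ((\sum_(k <- zball M) (odz k ^+ 2 - n%:Z) *
        count3 M (three_sq (4 * n%:Z - odz k ^+ 2))) * count3 M (tri3 3) -
      count3 M (three_sq 3) * \sum_(k <- zball M) (odz k ^+ 2 - n%:Z) *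
        count3 M (tri3 (4 * n%:Z - odz k ^+ 2))).
    rewrite mulr_suml mulr_sumr -sumrB.
    by apply: eq_bigr => k _; rewrite /d; ring.
  by rewrite three_sq_recursion tri_recursion// mul0r mulr0 subrr.
(* Here [4n - odz k ^+ 2 = 4 (n - k (k + 1)) - 1], and [n - k (k + 1)] is odd and smaller than [n]:
   either the induction hypothesis applies, or the argument is negative and both counts are 0. *)
have d0 k : k != 0 -> k != -1 -> d (4 * n%:Z - odz k ^+ 2) = 0.
  move=> k0 k1.
  have kk : 0 < k * (k + 1) by nia.
  have [z zE] := mul_succ_even k.
  have -> : 4 * n%:Z - odz k ^+ 2 = 4 * (n%:Z - 2 * z) - 1 by rewrite -zE; ring.
  have [zn|zn] := ltP (2 * z) n%:Z.
    have e : n%:Z - 2 * z = (n - absz (2 * z))%:Z by lia.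
    by rewrite e /d IH ?subrr//; lia.
  rewrite /d (@count3_eq0 _ (three_sq (4 * _ - 1))); last first.
    move=> x y w; apply/negP => /eqP e.
    have : 0 <= odz x ^+ 2 + odz y ^+ 2 + odz w ^+ 2.
      by rewrite !addr_ge0 ?sqr_ge0.
    by rewrite e; lia.
  rewrite (@count3_eq0 _ (tri3 (4 * _ - 1))) ?mul0r ?mulr0 ?subrr// => x y w.
  by apply/negP => /and4P[? ? ? /eqP]; nia.
(* Only [k = 0] and [k = -1], the halves of 1 and -1, remain, so [2 (1 - n) d (4n - 1) = 0]. *)
move: rec; rewrite (bigD1_seq 0) ?zball_uniq ?mem_zball//=; last by lia.
rewrite big_mkcond (bigD1_seq (-1)) ?zball_uniq ?mem_zball//=; last by lia.
rewrite big1 ?addr0; last first.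
  by move=> k k1; case: ifP => // k0; rewrite d0// mulr0.
have -> : odz 0 ^+ 2 = 1 :> int by [].
have -> : odz (-1) ^+ 2 = 1 :> int by [].
by move=> /eqP; rewrite -mulrDl mulf_eq0 => /orP[/eqP|/eqP//]; lia.
Qed.

Lemma three_odd_squares (D : int) : 0 < D -> (D %% 8)%Z = 3 ->
  exists x y z : int, odz x ^+ 2 + odz y ^+ 2 + odz z ^+ 2 = D.
Proof.
move=> D0 D3; pose n := absz ((D + 1) %/ 4)%Z.
have DE : D = 4 * n%:Z - 1 by rewrite /n; lia.
have n_odd : odd n by lia.
have := three_sq_tri3 n_odd (leqnn (4 * n)); rewrite -DE; set M := (4 * n)%N.
move=> e.
have [[x [y [z]]]|none] := pselect (exists x y z, three_sq D x y z).
  by move=> /eqP; exists x, y, z.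
have c0 : count3 M (three_sq D) = 0.
  by apply: count3_eq0 => x y z; apply/negP => h; apply: none; exists x, y, z.
have c1 : 0 < count3 M (three_sq 3).
  by apply: (@count3_gt0 _ _ 0 0 0); rewrite ?mem_zball//; lia.
(* [A = B = 1] and [C = 2n - 1] give [AB + BC + CA = 4n - 1]. *)
have c2 : 0 < count3 M (tri3 D).
  apply: (@count3_gt0 _ _ 0 0 (n%:Z - 1)); rewrite ?mem_zball /tri3; lia.
by have := mulr_gt0 c1 c2; rewrite -e c0 mul0r ltxx.
Qed.

(** * Cauchy's four numbers *)

Lemma cauchy_four_numbers (b D : int) :
  (b %% 2)%Z = 1 -> 0 < D -> (D %% 8)%Z = 3 ->
  exists x1 x2 x3 x4 : int,
    [/\ x1 + x2 + x3 + x4 = b,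
        4 * (x1 ^+ 2 + x2 ^+ 2 + x3 ^+ 2 + x4 ^+ 2) = b ^+ 2 + D &
        forall y, y \in [:: x1; x2; x3; x4] -> (4 * y - b) ^+ 2 <= 3 * D].
Proof.
move=> b1 D0 D3; have [x [y [z xyz]]] := three_odd_squares D0 D3.
(* The sum of the four odd numbers is even, and changing the sign of the last one changes it by 2
   modulo 4. *)
have [X [Y [Z [t [hX hY hZ ht]]]]] : exists X Y Z t : int,
    [/\ X = 2 * x + 1, Y = 2 * y + 1, Z ^+ 2 = (2 * z + 1) ^+ 2 &
        b + X + Y + Z = 4 * t].
  have [h|h] : ((b + 2 * x + 2 * y + 2 * z + 3) %% 4)%Z = 0 \/
               ((b + 2 * x + 2 * y - 2 * z + 1) %% 4)%Z = 0 by lia.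
    exists (2 * x + 1), (2 * y + 1), (2 * z + 1),
      ((b + 2 * x + 2 * y + 2 * z + 3) %/ 4)%Z; split => //; lia.
  exists (2 * x + 1), (2 * y + 1), (- (2 * z + 1)),
    ((b + 2 * x + 2 * y - 2 * z + 1) %/ 4)%Z; split => //; [exact: sqrrN|lia].
have ZE : exists w, Z = 2 * w + 1.
  by exists (2 * t - x - y - 2 - (b %/ 2)%Z); lia.
have [w wE] := ZE.
have {xyz} DE : X ^+ 2 + Y ^+ 2 + Z ^+ 2 = D by rewrite hX hY hZ.
have norm_le (u v r : int) : u ^+ 2 = X ^+ 2 -> v ^+ 2 = Y ^+ 2 ->
    r ^+ 2 = Z ^+ 2 -> (u + v + r) ^+ 2 <= 3 * D.
  move=> hu hv hr; rewrite -DE -hu -hv -hr -subr_ge0.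
  have -> : 3 * (u ^+ 2 + v ^+ 2 + r ^+ 2) - (u + v + r) ^+ 2 =
    (u - v) ^+ 2 + (v - r) ^+ 2 + (r - u) ^+ 2 by ring.
  by rewrite !addr_ge0 ?sqr_ge0.
(* These are [(b + X + Y + Z) / 4] and the three numbers obtained from it by changing two of the
   signs of [X], [Y], [Z]. *)
exists t, (t - y - w - 1), (t - x - w - 1), (t - x - y - 1).
split; first by lia.
- have bE : b = 4 * t - X - Y - Z by lia.
  by rewrite bE -DE hX hY wE; ring.
- move=> v; rewrite !inE => /or4P[]/eqP->.
  + have -> : 4 * t - b = X + Y + Z by lia.
    exact: norm_le.
  + have -> : 4 * (t - y - w - 1) - b = X + - Y + - Z by lia.
    by apply: norm_le; rewrite ?sqrrN.
  + have -> : 4 * (t - x - w - 1) - b = - X + Y + - Z by lia.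
    by apply: norm_le; rewrite ?sqrrN.
  + have -> : 4 * (t - x - y - 1) - b = - X + - Y + Z by lia.
    by apply: norm_le; rewrite ?sqrrN.
Qed.

(** As [n - w] is odd, so is [n - w ^+ 2]; the first term is thus 4 modulo 8, and the odd square is
    1. *)
Lemma cauchy_discriminant (n m w : int) : ((n - w) %% 2)%Z = 1 ->
  ((4 * (2 * m + n - w ^+ 2) - (n - w) ^+ 2) %% 8)%Z = 3.
Proof.
move=> b1.
have [j jE] : exists j, n - w = 2 * j + 1 by exists ((n - w) %/ 2)%Z; lia.
have [i iE] := mul_succ_even j; have [h hE] := mul_succ_even w.
have nE : n = w + (2 * j + 1) by lia.
have -> : 4 * (2 * m + n - w ^+ 2) - (n - w) ^+ 2 =
    8 * (m + w + j - h - i) + 3.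
  have -> : 8 * (m + w + j - h - i) + 3 = 8 * m + 8 * w + 8 * j + 3 -
    4 * (2 * h) - 4 * (2 * i) by ring.
  by rewrite -iE -hE nE; ring.
lia.
Qed.

(** * Choice of the fifth number and size estimates *)

Lemma opposite_parity (n v : int) :
  ((n - (2 * v + ((n + 1) %% 2)%Z)) %% 2)%Z = 1.
Proof. lia. Qed.

(** Here [q ^+ 4] is [n], [L] is [log n], [d] is [n / log n] and [s] is the square root in the
    formula for [x5]. The first and third bounds will give [x_i >= 1], the second
    [x_i <= n / 5 - d]. From [L <= 4 * q] and [q >= 40] one gets
    [d >= q ^+ 3 / 4 >= 10 * q ^+ 2]. *)
Lemma size_estimates (R : realFieldType) (q L d s : R) :
  40 <= q -> 100 <= L -> L <= 4 * q -> d = q ^+ 4 / L -> 0 <= s ->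
  40 * (q ^+ 4 * d) <= s ^+ 2 ->
  s ^+ 2 <= 16 * (q ^+ 4) ^+ 2 - 40 * (q ^+ 4 * d) ->
  [/\ s <= 4 * q ^+ 4 - 5 * d, 20 * d + 10 + 35 * q ^+ 2 <= s &
      7 * q ^+ 2 + 4 <= d].
Proof.
move=> q40 L100 Lq dE s0 slo shi.
have L0 : 0 < L by lra.
have q0 : 0 < q by lra.
set n := q ^+ 4 in dE slo shi *.
have n0 : 0 < n by rewrite exprn_gt0.
have d0 : 0 < d by rewrite dE divr_gt0.
have ndL : n = d * L by rewrite dE divfK// gt_eqF.
have dq : 10 * q ^+ 2 <= d.
  rewrite dE ler_pdivlMr//; apply: (@le_trans _ _ (10 * q ^+ 2 * (4 * q))).
    by rewrite ler_wpM2l// mulr_ge0 ?exprn_ge0// ltW.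
  have -> : n = q ^+ 2 * q * q by rewrite /n; ring.
  have -> : 10 * q ^+ 2 * (4 * q) = q ^+ 2 * q * 40 by ring.
  by rewrite ler_wpM2l// mulr_ge0 ?exprn_ge0// ltW.
have q2 : 1600 <= q ^+ 2.
  have -> : 1600 = 40 ^+ 2 :> R by ring.
  by rewrite ler_pXn2r ?nnegrE//; lra.
have dn : 100 * d <= n by rewrite ndL mulrC ler_wpM2l// ltW.
split; last by lra.
- rewrite -(@ler_pXn2r _ 2) ?nnegrE//; last by lra.
  apply: le_trans shi _; rewrite -subr_ge0.
  have -> : (4 * n - 5 * d) ^+ 2 - (16 * n ^+ 2 - 40 * (n * d)) = 25 * d ^+ 2.
    by ring.
  by rewrite mulr_ge0 ?exprn_ge0// ltW.
- suff : 60 * d <= s by lra.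
  rewrite -(@ler_pXn2r _ 2) ?nnegrE//; last by lra.
  apply: le_trans slo.
  have -> : (60 * d) ^+ 2 = 3600 * d * d by ring.
  by rewrite mulrA ler_wpM2r ?ltW//; lra.
Qed.

Lemma representable (R : realType) (n : nat) (m : int) (q : R) :
  40 <= q -> n%:R = q ^+ 4 -> 100 <= ln n%:R :> R ->
  n%:R ^+ 2 / 10 + n%:R ^+ 2 / ln n%:R <= m%:~R :> R ->
  m%:~R <= (n%:R ^+ 2 - n%:R) / 2 - n%:R ^+ 2 / ln n%:R :> R ->
  representation R n m !=set0.
Proof.
move=> q40 nq L100 mlo mhi.
have q0 : 0 < q by lra.
set L : R := ln n%:R in L100 mlo mhi *.
have Lq : L <= 4 * q.
  by rewrite /L nq lnXn//; have := ln_sublinear q0; lra.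
pose N : int := 2 * m + n%:Z.
(* The larger root of [x^2 + (n - x)^2 / 4 = N] is [(n + sqrt T) / 5]. *)
pose T : int := 20 * N - 4 * n%:Z ^+ 2.
have TE : T%:~R = 40 * m%:~R + 20 * n%:R - 4 * n%:R ^+ 2 :> R.
  by rewrite /T /N !(rmorphB, rmorphD, rmorphM, rmorphXn) /= -!pmulrn; ring.
pose d : R := q ^+ 4 / L.
have L0 : 0 < L by lra.
have dE : n%:R ^+ 2 / L = q ^+ 4 * d by rewrite nq /d expr2 mulrA.
have n1 : 0 <= n%:R :> R by exact: ler0n.
rewrite dE nq in mlo mhi; rewrite nq in TE n1.
have Tlo : 40 * (q ^+ 4 * d) <= T%:~R by rewrite TE; lra.
have Thi : T%:~R <= 16 * (q ^+ 4) ^+ 2 - 40 * (q ^+ 4 * d) by rewrite TE; lra.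
have d0 : 0 <= d by apply: divr_ge0 => //; exact: ltW.
have T0 : 0 <= T%:~R :> R by have := mulr_ge0 n1 d0; lra.
pose s : R := Num.sqrt T%:~R.
have s0 : 0 <= s by exact: sqrtr_ge0.
have sT : s ^+ 2 = T%:~R by exact: sqr_sqrtr.
have [shi slo dlo] : [/\ s <= 4 * q ^+ 4 - 5 * d,
    20 * d + 10 + 35 * q ^+ 2 <= s & 7 * q ^+ 2 + 4 <= d].
  by apply: (@size_estimates R q L d s) => //; rewrite sT.
pose e : int := ((n%:Z + 1) %% 2)%Z.
(* This makes [w], which is [x5], the largest number of parity opposite to [n] with
   [5 * w - n <= s]. Such [w] are 2 apart, hence [s < u + 10] below. *)
pose v : int := Num.floor ((s + n%:R - 5 * e%:~R) / 10).
pose w : int := 2 * v + e.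
have wn : ((n%:Z - w) %% 2)%Z = 1 by exact: opposite_parity.
pose u : int := 5 * w - n%:Z.
have uE : u%:~R = 10 * v%:~R + 5 * e%:~R - n%:R :> R.
  by rewrite /u /w !(rmorphB, rmorphD, rmorphM) /= -!pmulrn; ring.
have us : u%:~R <= s.
  have := floor_le_tmp ((s + n%:R - 5 * e%:~R) / 10); rewrite -/v uE; lra.
have su : s < u%:~R + 10.
  have := floorD1_gt ((s + n%:R - 5 * e%:~R) / 10); rewrite -/v intrD uE; lra.
have q2 : 0 <= q ^+ 2 by exact: sqr_ge0.
have u0 : 0 <= u%:~R :> R by lra.
pose b : int := n%:Z - w.
pose D : int := 4 * (N - w ^+ 2) - b ^+ 2.
have DE : 5 * D = T - u ^+ 2 by rewrite /D /T /u /b; ring.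
have DR : 5 * D%:~R = (s - u%:~R) * (s + u%:~R) :> R.
  have -> : 5 * D%:~R = (5 * D)%:~R :> R by rewrite rmorphM.
  by rewrite DE rmorphB rmorphXn /= -sT subr_sqr.
have D_ge0 : 0 <= D%:~R :> R.
  suff : 0 <= 5 * D%:~R :> R by lra.
  by rewrite DR mulr_ge0//; lra.
have D_le : D%:~R <= 16 * q ^+ 4 :> R.
  suff : 5 * D%:~R <= 10 * (8 * q ^+ 4) :> R by lra.
  by rewrite DR; apply: ler_pM; lra.
have D3 : (D %% 8)%Z = 3 by exact: cauchy_discriminant.
have D0 : 0 < D.
  by move: D_ge0; rewrite ler0z le_eqVlt => /orP[/eqP D0|//]; rewrite -D0 in D3.
have [x1 [x2 [x3 [x4 [xb xD xbd]]]]] := cauchy_four_numbers wn D0 D3.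
exists (x1, x2, x3, x4); split; last first.
  apply: (@mulfI _ (4 : int)) => //.
  by rewrite mulrDr xD xb /D /b /N; ring.
move=> y /xbd ybd.
(* [3 * D <= 48 * q ^+ 4 <= (7 * q ^+ 2) ^+ 2]. *)
have yb : `|4 * y%:~R - b%:~R| <= 7 * q ^+ 2 :> R.
  rewrite -(@ler_pXn2r _ 2) ?nnegrE//; last by lra.
  rewrite -normrX ger0_norm ?sqr_ge0//.
  have : ((4 * y - b) ^+ 2)%:~R <= (3 * D)%:~R :> R by rewrite ler_int.
  rewrite rmorphXn rmorphB !rmorphM /= -!pmulrn => /le_trans; apply.
  have -> : (7 * q ^+ 2) ^+ 2 = 49 * q ^+ 4 :> R by ring.
  by lra.
have bE : 5 * b%:~R = 4 * q ^+ 4 - u%:~R :> R.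
  have -> : b%:~R = n%:R - (2 * v%:~R + e%:~R) :> R.
    by rewrite /b /w !(rmorphB, rmorphD, rmorphM) /= -!pmulrn.
  by rewrite uE -nq; ring.
move: yb; rewrite ler_norml => /andP[ylo yhi].
split.
  rewrite -(ler_int R); lra.
by rewrite -/L nq -/d; lra.
Qed.

Lemma exceptional_set0 (R : realType) (n : nat) :
  40 ^+ 4 <= n%:R :> R -> 100 <= ln n%:R :> R -> exceptional R n = set0.
Proof.
move=> n40 L100; apply/seteqP; split => // m [mlo [mhi]].
pose q : R := Num.sqrt (Num.sqrt n%:R).
have nq : n%:R = q ^+ 4 by rewrite (exprM q 2 2) !sqr_sqrtr ?sqrtr_ge0.
have q40 : 40 <= q.
  by rewrite -(@ler_pXn2r _ 4) ?nnegrE ?sqrtr_ge0// -nq.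
have [x xr] := representable q40 nq L100 mlo mhi.
move=> /eqP; rewrite /nb_representations cardfs_eq0 => /eqP r0.
have : x \in fset_set (representation R n m).
  by rewrite in_fset_set ?inE//; exact: representation_finite.
by rewrite r0 inE.
Qed.

Theorem theorem4p4 (R : realType) :
  (fun n : nat => #|` fset_set (exceptional R n)|%:R : R^o) =O_ \oo
  (fun n : nat => n%:R `^ (2 - 1 / 50) : R^o).
Proof.
apply/eqO_exP; exists 1 => //=.
(* The two terms ensure [n ^ (1/4) >= 40] and [log n >= 100]; from there on the left-hand side is 0,
   so any positive constant serves. *)
exists (Num.truncn (40 ^+ 4 + expR 100 : R)).+1 => //= n /= nN.
have nR : 40 ^+ 4 + expR 100 <= n%:R :> R.
  by apply/ltW/(lt_le_trans (truncnS_gt _)); rewrite ler_nat.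
have e0 := expR_gt0 (100 : R).
have n40 : 40 ^+ 4 <= n%:R :> R by apply: le_trans nR; rewrite lerDl ltW.
rewrite exceptional_set0 ?fset_set0 ?cardfs0 ?normr0 ?mulr_ge0//.
rewrite -[leLHS](expRK (100 : R)) ler_ln ?posrE//.
  by apply: le_trans nR; rewrite lerDr exprn_ge0.
by apply: lt_le_trans n40; rewrite exprn_gt0.
Qed.
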